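(* Let $\Delta\ge 2$ be an integer and let $T$ be a rooted tree in which every vertex has at most $\Delta$ children. Then $$\rho_C(T)\ge \frac{L(T)-1}{\Delta-1}.$$ Equality holds if and only if $T$ is a complete $\Delta$-ary tree, i.e. a rooted tree in which all leaves lie on the same level and every internal (non-leaf) vertex has exactly $\Delta$ children.
   Context: A rooted tree $T$ has a distinguished vertex $r$, the root; the level $\ell(v)$ of a vertex $v$ is its distance from $r$. A leaf is a vertex without children (the root counts as a leaf only if it is the only vertex). $\mathcal{L}(T)$ denotes the set of leaves and $L(T)=|\mathcal{L}(T)|$. For vertices $v,w$, $v\vee w$ denotes the common ancestor of $v$ and $w$ farthest from the root (every vertex is an ancestor of itself). If $v_1,\ldots,v_n$ are the leaves, the ancestral matrix $C(T)$ is the $n\times n$ matrix with $(i,j)$ entry $\ell(v_i\vee v_j)$. $\rho_C(T)$ denotes the largest eigenvalue of $C(T)$. *)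

(* Defs.v *)
From HB Require Import structures.
From mathcomp Require Import all_boot all_order all_algebra.
From mathcomp Require Import boolp classical_sets reals.
From mathcomp Require Import complex polyrcf.

Set Implicit Arguments.
Unset Strict Implicit.
Unset Printing Implicit Defensive.

Import Order.TTheory GRing.Theory Num.Theory.

(* A finite tree is a connected simple graph without cycles.  A one-vertex
   [ucycle] would be a loop, and every edge is a [ucycle] of size 2, so the
   genuine cycles are exactly the [ucycle]s of size at least 3. *)
Record rooted_tree := RootedTree {
  vertex :> finType;
  edge : rel vertex;
  troot : vertex;
  edge_sym : symmetric edge;
  edge_irrefl : irreflexive edge;
  edge_connected : forall u v : vertex, connect edge u v;
  edge_acyclic : forall c : seq vertex, ucycle edge c -> size c <= 2 }.

Section RootedTree.
Variable T : rooted_tree.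
Implicit Types u v w : T.

Definition has_walk u v (k : nat) : bool :=
  [exists p : k.-tuple T, path (@edge T) u p && (last u p == v)].

Lemma has_walk_ex u v : exists k, has_walk u v k.
Proof.
have /connectP[p up ->] := edge_connected u v.
by exists (size p); apply/existsP; exists (in_tuple p); rewrite up eqxx.
Qed.

Definition dist u v : nat := ex_minn (has_walk_ex u v).

Definition level v : nat := dist (troot T) v.

(* [child u v]: v is a child of u *)
Definition child u v : bool := edge u v && (level v == (level u).+1).

Definition children u : {set T} := [set v | child u v].

(* [ancestor u v]: u is an ancestor of v; [connect] is the reflexive
   transitive closure *)
Definition ancestor u v : bool := connect child u v.

Definition leaf v : bool := children v == finset.set0.

Definition leaves : {set T} := [set v | leaf v].

(* The default [troot T] is itself a common ancestor ([ancestor_root]), so the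
   maximum is taken over the nonempty set of common ancestors. *)
Definition join v w : T :=
  [arg max_(u > troot T | ancestor u v && ancestor u w) level u].

Definition nleaves : nat := #|leaves|.

End RootedTree.

Arguments nleaves : clear implicits.

Definition ancestral_mx (R : realType) (T : rooted_tree) : 'M[R]_(nleaves T) :=
  \matrix_(i, j) ((level (join (enum_val i) (enum_val j)))%:R)%R.

(* The supremum is a maximum: see [rho_C_max]. *)
Definition rho_C (R : realType) (T : rooted_tree) : R :=
  sup [set a : R | eigenvalue (ancestral_mx R T) a]%classic.

Definition complete_ary (Delta : nat) (T : rooted_tree) : Prop :=
  (forall v w : T, leaf v -> leaf w -> level v = level w) /\
  (forall v : T, ~~ leaf v -> #|children v| = Delta).

Section Facts.
Variable T : rooted_tree.
Implicit Types u v w : T.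

Lemma level_root : level (troot T) = 0.
Proof.
rewrite /level /dist; case: ex_minnP => k _ /(_ 0) kmin; apply/eqP.
by rewrite -leqn0 kmin //; apply/existsP; exists [tuple]; rewrite /= eqxx.
Qed.

Lemma level_walk k v : has_walk (troot T) v k -> level v <= k.
Proof. by rewrite /level /dist; case: ex_minnP => n _; apply. Qed.

Lemma ancestor_root v : ancestor (troot T) v.
Proof.
move: {2}(level v) (erefl (level v)) => n; elim: n v => [|n IHn] v lv.
  move: lv; rewrite /level /dist; case: ex_minnP => k + _ k0; rewrite k0.
  case/existsP => p; rewrite (tuple0 p) /= => /eqP <-; exact: connect0.
have : has_walk (troot T) v (level v).
  by rewrite /level /dist; case: ex_minnP.
rewrite lv => /existsP[p]; case: p => p /= /eqP.
elim/last_ind: p => [|p x _] // ; rewrite size_rcons => -[sp].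
rewrite last_rcons rcons_path => /andP[/andP[rp px] /eqP xv]; subst x.
set u := last _ p in px.
have wu : has_walk (troot T) u n.
  by apply/existsP; rewrite -sp; exists (in_tuple p); rewrite rp eqxx.
have lu : level u = n.
  apply/eqP; rewrite eqn_leq level_walk //= -ltnS -lv.
  have : has_walk (troot T) u (level u).
    by rewrite /level /dist; case: ex_minnP.
  case/existsP => q /andP[rq /eqP qu]; apply: level_walk; apply/existsP.
  by exists [tuple of rcons q v]; rewrite /= rcons_path last_rcons rq qu px eqxx.
apply: (connect_trans (IHn u lu)); apply: connect1.
by rewrite /child px lv lu eqxx.
Qed.

Lemma leaves_gt0 : 0 < nleaves T.
Proof.
have [v _ vmax] := @arg_maxnP _ (troot T) xpredT (@level T) isT.
apply/card_gt0P; exists v; rewrite inE; apply/eqP/setP => w.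
rewrite !inE; apply/negP => /andP[_ /eqP lw].
by have := vmax w isT; rewrite /= lw ltnn.
Qed.

Lemma joinP v w : [/\ ancestor (join v w) v, ancestor (join v w) w &
  forall u, ancestor u v -> ancestor u w -> level u <= level (join v w)].
Proof.
rewrite /join; case: arg_maxnP => [|u /andP[uv uw] umax].
  by rewrite !ancestor_root.
by split=> // x xv xw; apply: umax; rewrite xv.
Qed.

Lemma level_joinC v w : level (join v w) = level (join w v).
Proof.
have [av aw am] := joinP v w; have [bw bv bm] := joinP w v.
by apply/eqP; rewrite eqn_leq bm // am.
Qed.

End Facts.

Local Open Scope ring_scope.

Lemma sym_eigenvalue (R : realType) n (A : 'M[R]_n) :
  (0 < n)%N -> A^T = A -> exists a, eigenvalue A a.
Proof.
case: n A => // n A _ symA.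
pose B := map_mx (real_complex R) A.
have /closed_rootP[z] : size (char_poly B) != 1%N by rewrite size_char_poly.
rewrite -eigenvalue_root_char => /eigenvalueP[v vB v0].
pose w := (map_mx Num.conj v)^T.
pose s := (v *m w) 0 0.
have s0 : s != 0.
  apply: contraNneq v0 => s0; apply/eqP/rowP => i; rewrite mxE.
  apply/eqP; rewrite -normr_eq0 -sqrf_eq0 normCK.
  move: s0; rewrite /s mxE => /eqP; rewrite psumr_eq0 => [/allP/(_ i)|j _].
    by rewrite mem_index_enum !mxE => /(_ isT).
  by rewrite !mxE mul_conjC_ge0.
have BC : map_mx Num.conj B = B.
  by apply/matrixP => i j; rewrite !mxE conj_Creal // complex_real.
have BT : B^T = B by rewrite /B map_trmx symA.
have Bw : B *m w = Num.conj z *: w.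
  rewrite -{1}BT /w -trmx_mul -{1}BC -map_mxM vB map_mxZ.
  by rewrite linearZ.
have zz : Num.conj z = z.
  apply: (mulIf s0); transitivity ((v *m B *m w) 0 0).
    by rewrite -mulmxA Bw -scalemxAr mxE.
  by rewrite vB -scalemxAl mxE.
have /CrealP/complex_realP[a za] := zz.
exists a; rewrite eigenvalue_root_char -(fmorph_root (real_complex R)).
rewrite map_char_poly -eigenvalue_root_char.
by apply/eigenvalueP; exists v => //; rewrite vB za.
Qed.

Lemma rho_C_max (R : realType) (T : rooted_tree) :
  eigenvalue (ancestral_mx R T) (rho_C R T) /\
  (forall a : R, eigenvalue (ancestral_mx R T) a -> a <= rho_C R T).
Proof.
set A := ancestral_mx R T.
have symA : A^T = A by apply/matrixP => i j; rewrite !mxE level_joinC.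
have [a0 ea0] := sym_eigenvalue (leaves_gt0 T) symA.
have cp0 : char_poly A != 0 by rewrite monic_neq0 // char_poly_monic.
pose s := rootsR (char_poly A).
have sE a : (a \in s) = eigenvalue A a.
  by rewrite -(roots_on_rootsR cp0) eigenvalue_root_char.
pose m := \big[Num.max/a0]_(a <- s) a.
have m_ub a : eigenvalue A a -> a <= m.
  by rewrite -sE => sa; apply: le_bigmax_seq.
have me : eigenvalue A m.
  rewrite /m big_seq; elim/big_ind: _ => // [x y|x]; last by rewrite sE.
  by rewrite /Num.max; case: ifP.
suff -> : rho_C R T = m by [].
apply/eqP; rewrite eq_le; apply/andP; split.
  by apply: ge_sup; [exists a0|move=> x /m_ub].
by apply: ub_le_sup => //; exists m => x /m_ub.
Qed.

(* Main.v *)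
Require Import Defs.
From mathcomp Require Import all_boot all_order all_algebra.
From mathcomp Require Import reals.
From mathcomp Require Import complex spectral sesquilinear.
From mathcomp Require Import ring.

(* Let n_v be the number of leaves below v.  Since the level of a join counts
   the common non-root ancestors, C(T) is the sum over v <> r of the rank-one
   matrices of the indicator vectors of the leaves below v.  The Rayleigh
   quotient at the all-ones vector gives rho * n >= S, where S is the sum of
   n_v^2 over v <> r.  The Cauchy-Schwarz inequality at each internal vertex
   (n_v is the sum of n_c over at most Delta children c), summed over the tree,
   telescopes to (Delta - 1) S >= n (n - 1).  Equality forces every internal
   vertex to have Delta children with n_c = n_v / Delta, hence a leaf at level
   l satisfies Delta^l = n.  Conversely, in a complete tree every row sum of
   C(T) telescopes to (n - 1) / (Delta - 1), and the largest row sum of a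
   nonnegative matrix bounds its eigenvalues. *)

Import Order.TTheory GRing.Theory Num.Theory.
Local Open Scope ring_scope.
Local Open Scope sesquilinear_scope.

(** * Rayleigh quotients of real symmetric matrices *)

(** Over the complex numbers [A] is unitarily diagonalisable with real diagonal [d]; in the
    eigenbasis coordinates [y] the form is the sum of [d 0 i * |y_i|^2], and each [d 0 i] is at most
    [r]. *)
Lemma rayleigh_le (R : rcfType) n (A : 'M[R]_n) (r : R) (x : 'rV[R]_n) :
  A^T = A -> (forall a, eigenvalue A a -> a <= r) ->
  (x *m A *m x^T) 0 0 <= r * (x *m x^T) 0 0.
Proof.
move=> symA ub; pose iota := real_complex R.
pose B := map_mx iota A; pose z := map_mx iota x.
have Bherm : B \is hermsymmx.
  apply: realsym_hermsym; last by apply/mxOverP => i j; rewrite mxE complex_real.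
  by apply/is_hermitianmxP; rewrite expr0 scale1r map_mx_id // /B map_trmx symA.
have /hermitian_normalmx/orthomx_spectralP := Bherm.
set P := spectralmx B; set d := spectral_diag B => BE.
have Punit : P \is unitarymx := spectral_unitarymx B.
have zT : z ^t* = map_mx iota x^T.
  by apply/matrixP => i j; rewrite !mxE conj_Creal // complex_real.
pose y := z *m P^t*.
have dE i : exists2 a, d 0 i = iota a & a <= r.
  have /mxOverP/(_ 0 i)/complex_realP[a da] := hermitian_spectral_diag_real Bherm.
  exists a => //; apply: ub; rewrite -(eigenvalue_map iota) -/B.
  (* The rows of the unitary [P] are eigenvectors of [B], nonzero because [P] is invertible. *)
  apply/eigenvalueP; exists (row i P).
    rewrite -row_mul [X in row i (P *m X)]BE !mulmxA mulmxV ?unitarymx_unit //.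
    by rewrite mul1mx row_mul row_diag_mx -scalemxAl -rowE da.
  apply/eqP => rowP0; have : (delta_mx 0 i : 'rV_n) *m P *m invmx P = 0.
    by rewrite -rowE rowP0 mul0mx.
  rewrite mulmxK ?unitarymx_unit // => /matrixP/(_ 0 i)/eqP.
  by rewrite !mxE !eqxx oner_eq0.
have yE : y *m y ^t* = map_mx iota (x *m x^T).
  rewrite /y trmx_mul map_mxM trmxCK mulmxA mulmxKtV //.
  by rewrite zT -map_mxM.
have qE : y *m diag_mx d *m y ^t* = map_mx iota (x *m A *m x^T).
  rewrite /y trmx_mul map_mxM trmxCK.
  rewrite !map_mxM -/B -/z BE -zT invmx_unitary //.
  by rewrite !mulmxA.
have : iota ((x *m A *m x^T) 0 0) <= iota (r * (x *m x^T) 0 0).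
  rewrite [iota (r * _)](rmorphM (real_complex R)) /= -!/(iota _).
  have -> : iota ((x *m x^T) 0 0) = (y *m y ^t*) 0 0 by rewrite yE [RHS]mxE.
  have -> : iota ((x *m A *m x^T) 0 0) = (y *m diag_mx d *m y ^t*) 0 0.
    by rewrite qE [RHS]mxE.
  rewrite mul_mx_diag !mxE mulr_sumr; apply: ler_sum => i _.
  have [a da ar] := dE i.
  rewrite !mxE da mulrAC mulrC ler_wpM2r ?mul_conjC_ge0 //.
  by rewrite lecR.
by rewrite lecR.
Qed.

(** * Parents, ancestors and joins *)

Section Tree.
Set Implicit Arguments.
Unset Strict Implicit.
Context {T : rooted_tree}.
Implicit Types u v w c : T.
Local Open Scope nat_scope.

Lemma child_level u v : child u v -> level v = (level u).+1.
Proof. by case/andP=> _ /eqP. Qed.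

Lemma child_neq_root u v : child u v -> v != troot T.
Proof.
by move=> uv; apply: contra_eq_neq (child_level uv) => ->; rewrite level_root.
Qed.

Lemma tree_ind (P : T -> Prop) :
  P (troot T) -> (forall u v, child u v -> P u -> P v) -> forall v, P v.
Proof.
move=> P0 PS v; have /connectP[p + ->] := ancestor_root v.
elim/last_ind: p => [//|p x IHp]; rewrite rcons_path last_rcons.
by case/andP=> /IHp Pp /PS; apply.
Qed.

(* Two parents of [v] lie one level above [v], and the root joins them through
   vertices no deeper than themselves; closing up through [v] gives a cycle. *)
Lemma parent_uniq u u' v : child u v -> child u' v -> u = u'.
Proof.
move=> uv u'v; apply/eqP/negPn/negP => neq_uu'.
have lu' : level u' = level u.
  by apply: succn_inj; rewrite -(child_level uv) (child_level u'v).
pose e : rel T := [rel x y | [&& edge x y, level x <= level u & level y <= level u]].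
have e_sym : symmetric e by move=> x y; rewrite /e /= edge_sym [X in _ && X]andbC.
have e_root w : level w <= level u -> connect e (troot T) w.
  elim/tree_ind: w => [_|x y xy IHx]; first exact: connect0.
  move=> ly; have lx : level x <= level u by rewrite ltnW // -(child_level xy).
  apply: connect_trans (IHx lx) (connect1 _).
  by rewrite /e /= lx ly; case/andP: xy => ->.
have /connectP[p0 p0P lastp0] : connect e u u'.
  by rewrite (connect_trans _ (e_root u' _)) ?lu' // (sym_connect_sym e_sym) e_root.
case/shortenP: p0P lastp0 => p ep uniq_p _ last_p.
have lp : all (fun x => level x <= level u) (u :: p).
  rewrite /= leqnn /=; have sub_e : subrel e (fun _ y => level y <= level u).
    by move=> x y /and3P[].
  have := sub_path sub_e ep.
  by elim: p (X in path _ X) {ep uniq_p last_p} => //= y p IHp _ /andP[-> /IHp].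
have : ucycle (@edge T) (v :: u :: p).
  apply/andP; split.
    rewrite /= rcons_path -last_p edge_sym.
    have [/andP[-> _] /andP[-> _]] := (uv, u'v).
    by rewrite (sub_path _ ep) // => x y /and3P[].
  rewrite cons_uniq uniq_p andbT.
  by apply/negP => /(allP lp); rewrite (child_level uv) ltnn.
(* A cycle of size at most 2 leaves [p] empty, so [u'] would be [u]. *)
move/edge_acyclic; case: p last_p {ep uniq_p lp} => //= uu'.
by rewrite uu' eqxx in neq_uu'.
Qed.

(** A nonempty descending path to [v] makes its last step from the unique parent [u]. *)
Lemma ancestor_child w u v :
  child u v -> ancestor w v = (w == v) || ancestor w u.
Proof.
move=> uv; apply/idP/orP => [|[/eqP->|wu]]; last 2 first.
- exact: connect0.
- exact: connect_trans wu (connect1 uv).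
case/connectP => p; elim/last_ind: p => [_ /= ->|p x _]; first by left.
rewrite rcons_path last_rcons => /andP[wp px] xv; right.
rewrite -xv in px; rewrite (parent_uniq uv px).
by apply/connectP; exists p.
Qed.

Lemma ancestor_troot w : ancestor w (troot T) = (w == troot T).
Proof.
apply/idP/eqP => [|->]; last exact: connect0.
case/connectP => p; elim/last_ind: p => [//|p x _].
rewrite rcons_path last_rcons => /andP[_ px] xr.
by move: (child_level px); rewrite -xr level_root.
Qed.

Lemma ancestor_level u v : ancestor u v -> level u <= level v.
Proof.
elim/tree_ind: v => [|x y xy IHy]; first by rewrite ancestor_troot => /eqP->.
rewrite (ancestor_child _ xy) => /orP[/eqP-> //|/IHy].
by rewrite (child_level xy); exact: leqW.
Qed.

Lemma ancestor_chain u w v :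
  ancestor u v -> ancestor w v -> level u <= level w -> ancestor u w.
Proof.
elim/tree_ind: v => [|x y xy IHy].
  by rewrite !ancestor_troot => /eqP-> /eqP->; rewrite /ancestor connect0.
rewrite !(ancestor_child _ xy) => /orP[/eqP->|ux] /orP[/eqP->|wx].
- by rewrite /ancestor connect0.
- rewrite (child_level xy) => ll.
  by have := leq_trans ll (ancestor_level wx); rewrite ltnn.
- by rewrite (ancestor_child _ xy) ux orbT.
- exact: IHy.
Qed.

Lemma ancestor_level_inj u v : ancestor u v -> level u = level v -> u = v.
Proof.
elim/tree_ind: v => [|x y xy _]; first by rewrite ancestor_troot => /eqP->.
rewrite (ancestor_child _ xy) => /orP[/eqP-> //|/ancestor_level].
by rewrite (child_level xy) => + lu; rewrite lu ltnn.
Qed.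

(** Each step down adds exactly one ancestor. Read this way, the level of a join becomes a sum over
    vertices. *)
Lemma card_ancestors v :
  #|[set u | (u != troot T) && ancestor u v]| = level v.
Proof.
elim/tree_ind: v => [|x y xy IHy].
  rewrite level_root; apply/eqP; rewrite cards_eq0; apply/eqP/setP => u.
  by rewrite !inE ancestor_troot andNb.
rewrite (child_level xy) -IHy.
have -> : [set u | (u != troot T) && ancestor u y] =
          y |: [set u | (u != troot T) && ancestor u x].
  apply/setP => u; rewrite !inE (ancestor_child _ xy) andb_orr.
  congr (_ || _); apply: andb_idl => /eqP->.
  exact: child_neq_root xy.
rewrite cardsU1 inE; case: (boolP (ancestor y x)) => [yx|]; last by rewrite andbF.
by have := ancestor_level yx; rewrite (child_level xy) ltnn.
Qed.

(** [join] only maximises the level; since the ancestors of [v] form a chain, it is in fact the meet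
    for the ancestor order. *)
Lemma ancestor_join u v w : ancestor u (join v w) = ancestor u v && ancestor u w.
Proof.
have [jv jw jmax] := joinP v w.
apply/idP/andP => [uj|[uv uw]].
  by split; [exact: connect_trans uj jv|exact: connect_trans uj jw].
exact: ancestor_chain uv jv (jmax u uv uw).
Qed.

(** The entrywise form of the rank-one decomposition of the ancestral matrix. *)
Lemma level_join v w :
  level (join v w) = \sum_(u | u != troot T) ancestor u v * ancestor u w.
Proof.
rewrite -card_ancestors -sum1dep_card big_mkcondr /=; apply: eq_bigr => u _.
by rewrite ancestor_join; do 2 case: (ancestor _ _).
Qed.

(** Turns sums over parent-child pairs into sums over non-root vertices. *)
Lemma sum_parents (F : nat) c : \sum_(v | child v c) F = (c != troot T) * F.
Proof.
elim/tree_ind: c => [|x y xy _].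
  rewrite eqxx big_pred0 // => v; apply/negP => /child_level.
  by rewrite level_root.
rewrite (child_neq_root xy) mul1n (big_pred1 x) // => v; apply/idP/eqP => [|-> //].
by move=> vy; exact: parent_uniq vy xy.
Qed.

(** * Counting the leaves below a vertex *)

Definition nleaves_below v : nat := \sum_(w in leaves T) ancestor v w.

Lemma nleaves_below_root : nleaves_below (troot T) = nleaves T.
Proof.
by rewrite /nleaves -sum1_card; apply: eq_bigr => w _; rewrite ancestor_root.
Qed.

Lemma leaf_child v c : leaf v -> child v c = false.
Proof. by move/eqP/setP/(_ c); rewrite !inE. Qed.

Lemma ancestor_sum_children v w : v != w ->
  ancestor v w = \sum_(c | child v c) ancestor c w :> nat.
Proof.
move=> vw; case: (boolP (ancestor v w)) => [/connectP[[|c p] /=]|vNw].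
- by move=> _ wv; rewrite wv eqxx in vw.
- case/andP=> vc cp wE; have cw : ancestor c w by apply/connectP; exists p.
  rewrite (bigD1 c) //= cw big1 // => c' /andP[vc' c'c].
  apply/eqP; rewrite eqb0; apply: contraNN c'c => c'w.
  (* Two ancestors of [w] on the same level coincide, so only one child of [v] leads to [w]. *)
  have ll : level c' = level c by rewrite (child_level vc) (child_level vc').
  by apply/eqP/ancestor_level_inj => //; apply: ancestor_chain c'w cw _; rewrite ll.
- rewrite big1 // => c vc; apply/eqP; rewrite eqb0; apply: contraNN vNw.
  exact: connect_trans (connect1 vc).
Qed.

Lemma nleaves_below_leaf v : leaf v -> nleaves_below v = 1.
Proof.
move=> lv; rewrite /nleaves_below (bigD1 v) ?inE //=.
rewrite [ancestor v v]connect0 big1 // => w /andP[_ wv].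
rewrite ancestor_sum_children 1?eq_sym // big_pred0 // => c.
exact: leaf_child.
Qed.

Lemma nleaves_below_children v : ~~ leaf v ->
  nleaves_below v = \sum_(c | child v c) nleaves_below c.
Proof.
move=> lv; rewrite /nleaves_below exchange_big /=; apply: eq_bigr => w.
rewrite inE => lw; apply: ancestor_sum_children.
by apply: contraNneq lv => ->.
Qed.

Lemma child_ind (P : T -> Prop) :
  (forall v, (forall c, child v c -> P c) -> P v) -> forall v, P v.
Proof.
move=> PS v; have [m lm] : exists m, forall w : T, level w <= m.
  by exists (\max_(w : T) level w) => w; exact: leq_bigmax.
(* Bottom-up induction on the gap to the level bound [m]; at gap 0 a child would exceed [m]. *)
move: {2}(m - level v) (erefl (m - level v)) => k.
elim: k v => [|k IHk] v kE; apply: PS => c /child_level lc.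
  by have := lm c; rewrite lc -subn_gt0 kE.
by apply: IHk; rewrite lc subnS kE.
Qed.

Lemma nleaves_below_gt0 v : 0 < nleaves_below v.
Proof.
elim/child_ind: v => v IHv; case: (boolP (leaf v)) => [/nleaves_below_leaf->//|lv].
rewrite nleaves_below_children //.
have /set0Pn[c] := lv; rewrite inE => vc.
by rewrite (bigD1 c) //= addn_gt0 IHv.
Qed.

End Tree.

(** * Bounds on the spectral radius and the Cauchy-Schwarz defect *)

Section Spectral.
Context {R : realType} {T : rooted_tree}.
Set Implicit Arguments.
Unset Strict Implicit.
Implicit Types u v w c : T.
Notation n_ v := ((nleaves_below v)%:R : R).

Lemma sum_enum_val_leaves (F : T -> R) :
  \sum_(i < nleaves T) F (enum_val i) = \sum_(w in leaves T) F w.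
Proof. by rewrite [RHS]big_enum_val. Qed.

Lemma ancestral_mx_row_sum (i : 'I_(nleaves T)) :
  \sum_j ancestral_mx R T i j =
  \sum_(u : T | u != troot T) (ancestor u (enum_val i))%:R * n_ u.
Proof.
under eq_bigr do rewrite mxE level_join natr_sum.
rewrite exchange_big /=; apply: eq_bigr => u _.
rewrite /nleaves_below natr_sum mulr_sumr -sum_enum_val_leaves.
by apply: eq_bigr => j _; rewrite natrM.
Qed.

Lemma ancestral_mx_sum :
  \sum_i \sum_j ancestral_mx R T i j = \sum_(u : T | u != troot T) n_ u ^+ 2.
Proof.
under eq_bigr do rewrite ancestral_mx_row_sum.
rewrite exchange_big /=; apply: eq_bigr => u _.
rewrite -mulr_suml (sum_enum_val_leaves (fun w => (ancestor u w)%:R)).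
by rewrite -natr_sum.
Qed.

Lemma rho_C_ge_average :
  \sum_(u : T | u != troot T) n_ u ^+ 2 <= rho_C R T * (nleaves T)%:R.
Proof.
have symA : (ancestral_mx R T)^T = ancestral_mx R T.
  by apply/matrixP => i j; rewrite !mxE level_joinC.
have [_ ub] := rho_C_max R T.
have := @rayleigh_le R _ _ _ (const_mx 1) symA ub; rewrite -ancestral_mx_sum.
congr (_ <= _ * _).
  rewrite mxE exchange_big /=; apply: eq_bigr => j _.
  rewrite !mxE mulr1; apply: eq_bigr => i _; by rewrite mxE mul1r.
rewrite mxE; under eq_bigr do rewrite !mxE mulr1.
by rewrite sumr_const card_ord.
Qed.

(** Compare both sides of the eigenvector equation at a coordinate [k] of largest absolute value; by
    symmetry column [k] has the same sum as row [k]. *)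
Lemma rho_C_le_row_sum (r : R) :
  (forall i, \sum_j ancestral_mx R T i j <= r) -> rho_C R T <= r.
Proof.
move=> rows; have [/eigenvalueP[x xA x0] _] := rho_C_max R T.
have [i0 xi0] : exists i, x 0 i != 0.
  by apply/existsP; apply: contraNT x0 => /existsPn x0; apply/eqP/rowP => i;
    rewrite mxE; apply/eqP/negPn/x0.
have [k _ kmax] := @arg_maxP _ R _ i0 xpredT (fun i => `|x 0 i|) isT.
have xk : 0 < `|x 0 k| by apply: lt_le_trans (kmax i0 isT); rewrite normr_gt0.
rewrite -(ler_pM2r xk) -[X in _ * X]normr_id; apply: le_trans (ler_norm _) _.
rewrite normrM !normr_id -normrM.
have -> : rho_C R T * x 0 k = \sum_i x 0 i * ancestral_mx R T i k.
  by have /matrixP/(_ 0 k) := xA; rewrite !mxE => ->.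
apply: le_trans (ler_norm_sum _ _ _) _.
apply: le_trans (_ : (\sum_i ancestral_mx R T k i) * `|x 0 k| <= _); last first.
  by rewrite ler_wpM2r.
rewrite mulr_suml; apply: ler_sum => i _.
have -> : ancestral_mx R T k i = ancestral_mx R T i k by rewrite !mxE level_joinC.
have Cge0 : 0 <= ancestral_mx R T i k by rewrite mxE ler0n.
by rewrite normrM (ger0_norm Cge0) mulrC ler_wpM2l //; exact: kmax.
Qed.

(* Both summands on the right are nonnegative when [D] bounds the number of
   children; they vanish exactly when [v] has [D] children, each carrying
   [n_ v / D] leaves. *)
Lemma sum_children_sqr (D : R) v : ~~ leaf v ->
  D * (D * (\sum_(c | child v c) n_ c ^+ 2) - n_ v ^+ 2) =
  \sum_(c | child v c) (D * n_ c - n_ v) ^+ 2 + (D - #|children v|%:R) * n_ v ^+ 2.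
Proof.
move=> lv.
have E : \sum_(c | child v c) (D * n_ c - n_ v) ^+ 2 =
    D ^+ 2 * (\sum_(c | child v c) n_ c ^+ 2) - 2 * D * n_ v * n_ v +
    #|children v|%:R * n_ v ^+ 2.
  have -> : #|children v|%:R * n_ v ^+ 2 = \sum_(c | child v c) n_ v ^+ 2.
    by rewrite mulr_natl -sumr_const; apply: eq_bigl => c; rewrite inE.
  rewrite [X in _ * X%:R](nleaves_below_children lv) natr_sum !mulr_sumr.
  by rewrite -sumrB -big_split /=; apply: eq_bigr => c _; ring.
rewrite E; ring.
Qed.

(** Summing [sum_children_sqr], the squares of children run once over all non-root vertices, while
    those of internal vertices miss only the leaves, so nearly everything telescopes. *)
Lemma defect_sum (D : R) :
  \sum_(v : T | ~~ leaf v) (\sum_(c | child v c) (D * n_ c - n_ v) ^+ 2 +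
    (D - #|children v|%:R) * n_ v ^+ 2) =
  D * ((D - 1) * (\sum_(u : T | u != troot T) n_ u ^+ 2)
       - (nleaves T)%:R * ((nleaves T)%:R - 1)).
Proof.
under eq_bigr => v lv do rewrite -sum_children_sqr //.
rewrite -mulr_sumr sumrB -mulr_sumr; congr (_ * _).
have -> : \sum_(v : T | ~~ leaf v) \sum_(c | child v c) n_ c ^+ 2 =
    \sum_(u : T | u != troot T) n_ u ^+ 2.
  transitivity (\sum_(v : T) \sum_(c | child v c) n_ c ^+ 2).
    rewrite [RHS](bigID (@leaf T)) /= [X in _ = X + _]big1 ?add0r // => v lv.
    by rewrite big_pred0 // => c; exact: leaf_child.
  rewrite (exchange_big_dep xpredT) //= [RHS]big_mkcond; apply: eq_bigr => c _.
  have := sum_parents (nleaves_below c ^ 2)%N c.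
  move=> /(congr1 (fun m => m%:R : R)); rewrite natr_sum natrM natrX => ->.
  by case: (c != _); rewrite ?mul1r ?mul0r.
(* The sum over all vertices is split in two ways: leaves, each contributing 1, against internal
   vertices, and then the root against the rest. *)
have : \sum_(v : T) n_ v ^+ 2 =
   (nleaves T)%:R + \sum_(v : T | ~~ leaf v) n_ v ^+ 2.
  rewrite (bigID (@leaf T)) /=; congr (_ + _).
  rewrite /nleaves -sum1_card natr_sum; apply: eq_big => v; first by rewrite inE.
  by move=> lv; rewrite nleaves_below_leaf // expr1n.
rewrite (bigD1 (troot T)) //= nleaves_below_root => H.
have -> : \sum_(v : T | ~~ leaf v) n_ v ^+ 2 = (nleaves T)%:R ^+ 2 +
   \sum_(i | i != troot T) n_ i ^+ 2 - (nleaves T)%:R by rewrite H; ring.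
ring.
Qed.

(** * Complete trees and constant leaf ratios *)

Lemma nleaves_below_complete Delta (hDelta : (0 < Delta)%N) :
  complete_ary Delta T ->
  forall v c, child v c -> nleaves_below v = (Delta * nleaves_below c)%N.
Proof.
move=> [same_level full].
have [l ll] : exists l : T, leaf l.
  by have /card_gt0P[l] := leaves_gt0 T; rewrite inE; exists l.
(* Bottom-up, this product is the same at every vertex; its value is read off at the leaf [l]. *)
have below v : (nleaves_below v * Delta ^ level v = Delta ^ level l)%N.
  move: v; apply: child_ind => v IHv; have [lv|lv] := boolP (leaf v).
    by rewrite nleaves_below_leaf // mul1n (same_level v l).
  apply/eqP; rewrite -(eqn_pmul2l hDelta) -[X in _ == (X * _)%N](full v lv).
  rewrite nleaves_below_children // big_distrl big_distrr /=.
  rewrite -sum_nat_const [X in _ == X](eq_bigl (child v)); last by move=> c; rewrite inE.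
  apply/eqP/eq_bigr => c vc.
  by rewrite mulnCA -expnS -(child_level vc) IHv.
move=> v c vc; apply/eqP; rewrite -(@eqn_pmul2r (Delta ^ level v)) ?expn_gt0 ?hDelta //.
by rewrite below mulnAC -expnS -(child_level vc) mulnC below.
Qed.

Lemma complete_of_nleaves_below Delta (hDelta : (1 < Delta)%N) :
  (forall v : T, ~~ leaf v -> #|children v| = Delta) ->
  (forall v c, child v c -> nleaves_below v = (Delta * nleaves_below c)%N) ->
  complete_ary Delta T.
Proof.
move=> full ratio; split=> // v w lv lw.
(* The same invariant, now propagated down from the root; at a leaf it determines the level, as
   powers of [Delta] are injective. *)
have below u : (nleaves_below u * Delta ^ level u)%N = nleaves T.
  move: u; apply: tree_ind => [|x y xy IHx].
    by rewrite level_root muln1 nleaves_below_root.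
  by rewrite -IHx (ratio x y xy) (child_level xy) expnS mulnCA mulnA.
apply/eqP; rewrite -(eqn_exp2l _ _ hDelta); apply/eqP.
by have := below v; rewrite -(below w) !nleaves_below_leaf // !mul1n.
Qed.

(** A step from [x] down to a child [y] adds [n_ y] to the sum, and
    [(Delta - 1) * n_ y = n_ x - n_ y]. *)
Lemma row_sum_telescope Delta :
  (forall v c, child v c -> nleaves_below v = (Delta * nleaves_below c)%N) ->
  forall v, (Delta%:R - 1) * (\sum_(u : T | u != troot T) (ancestor u v)%:R * n_ u) =
    (nleaves T)%:R - n_ v.
Proof.
move=> ratio; apply: tree_ind => [|x y xy IHx].
  rewrite nleaves_below_root subrr big1 ?mulr0 // => u /negPf ur.
  by rewrite ancestor_troot ur mul0r.
have yr := child_neq_root xy.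
have yx : ancestor y x = false.
  by apply/negP => /ancestor_level; rewrite (child_level xy) ltnn.
have -> : \sum_(u : T | u != troot T) (ancestor u y)%:R * n_ u =
    n_ y + \sum_(u : T | u != troot T) (ancestor u x)%:R * n_ u.
  rewrite (bigD1 y) // [in RHS](bigD1 y) //= yx mul0r add0r.
  rewrite (ancestor_child _ xy) eqxx mul1r; congr (_ + _).
  by apply: eq_bigr => u /andP[_ /negPf uy]; rewrite (ancestor_child _ xy) uy.
rewrite mulrDr IHx (ratio x y xy) natrM; ring.
Qed.

End Spectral.

Theorem theorem2p4 (R : realType) (Delta : nat) (T : rooted_tree)
    (hDelta : (2 <= Delta)%N)
    (hT : forall v : T, (#|children v| <= Delta)%N) :
  ((nleaves T)%:R - 1) / (Delta%:R - 1) <= rho_C R T /\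
  (rho_C R T = ((nleaves T)%:R - 1) / (Delta%:R - 1) <->
   complete_ary Delta T).
Proof.
have D0 : 0 < Delta%:R :> R by rewrite ltr0n ltnW.
have D1 : 0 < Delta%:R - 1 :> R by rewrite subr_gt0 ltr1n.
have N0 : 0 < (nleaves T)%:R :> R by rewrite ltr0n leaves_gt0.
have := @defect_sum R T Delta%:R; have := @rho_C_ge_average R T.
set S : R := \sum_(u : T | u != troot T) (nleaves_below u)%:R ^+ 2.
set N := (nleaves T)%:R; set D := Delta%:R => S_le defE.
pose defect (v : T) : R :=
  \sum_(c | child v c) (D * (nleaves_below c)%:R - (nleaves_below v)%:R) ^+ 2 +
  (D - #|children v|%:R) * (nleaves_below v)%:R ^+ 2.
have dev_ge0 (v : T) : 0 <= \sum_(c | child v c)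
    (D * (nleaves_below c)%:R - (nleaves_below v)%:R) ^+ 2 :> R.
  by apply: sumr_ge0 => c _; exact: sqr_ge0.
have deg_ge0 (v : T) : 0 <= (D - #|children v|%:R) * (nleaves_below v)%:R ^+ 2 :> R.
  by rewrite mulr_ge0 ?sqr_ge0 // subr_ge0 ler_nat.
have def_ge0 (v : T) : ~~ leaf v -> 0 <= defect v by move=> _; exact: addr_ge0.
have NN_le : N * (N - 1) <= (D - 1) * S.
  by rewrite -subr_ge0 -(pmulr_rge0 _ D0) -defE sumr_ge0.
have bound : (N - 1) / (D - 1) <= rho_C R T.
  rewrite ler_pdivrMr // -(ler_pM2l N0); apply: le_trans NN_le _.
  by rewrite mulrA [N * _]mulrC (mulrC (D - 1)) ler_pM2r.
split=> //; split=> [rhoE|cplt].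
  have := @psumr_eq0P R T (fun v => ~~ leaf v) defect def_ge0.
  (* Under [rhoE], [S_le] gives the reverse of [NN_le]; the nonnegative defects then sum to 0 and
     vanish one by one. *)
  have -> : \sum_(v : T | ~~ leaf v) defect v = 0.
    rewrite defE; apply/eqP; rewrite mulf_eq0 (gt_eqF D0) /= subr_eq0 eq_le NN_le.
    rewrite andbT mulrC -ler_pdivlMr //; apply: le_trans S_le _.
    by rewrite rhoE mulrAC (mulrC N).
  move=> /(_ erefl) def0.
  have {}def0 (v : T) : ~~ leaf v ->
      #|children v| = Delta /\
      forall c, child v c -> nleaves_below v = (Delta * nleaves_below c)%N.
    move=> lv; have /eqP := def0 v lv.
    (* The degree term forces [Delta] children because [nleaves_below v] is positive; the squares
       force the ratio. *)
    rewrite paddr_eq0 // => /andP[/eqP sq0 /eqP deg0]; split=> [|c vc].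
      apply/eqP; move/eqP: deg0.
      by rewrite mulf_eq0 subr_eq0 eqr_nat expf_eq0 /= pnatr_eq0
        (gtn_eqF (nleaves_below_gt0 v)) orbF eq_sym.
    have /eqP := psumr_eq0P (fun c _ => sqr_ge0 _) sq0 vc.
    by rewrite sqrf_eq0 subr_eq0 -natrM eqr_nat => /eqP.
  apply: complete_of_nleaves_below => // [v /def0[]//|v c vc].
  have lv : ~~ leaf v by apply: contraL vc => /leaf_child ->.
  by have [_] := def0 v lv; apply.
(* Rows are indexed by leaves, where [nleaves_below] is 1, so every row sum telescopes to the same
   bound. *)
apply: le_anti; rewrite bound andbT; apply: rho_C_le_row_sum => i.
rewrite ancestral_mx_row_sum ler_pdivlMr // mulrC.
rewrite (row_sum_telescope (nleaves_below_complete (ltnW hDelta) cplt)).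
have := enum_valP i; rewrite inE => li.
by rewrite nleaves_below_leaf.
Qed.
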